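(* Suppose that $R$ is a regular local ring of dimension $d>0$ with maximal ideal $m_R$ and $\{I_n\}_{n\in\mathbb{N}}$ is a graded family of $m_R$-primary ideals in $R$. Then the limit $$ \lim_{n\rightarrow\infty} \frac{\ell_R(R/I_n)}{n^d} $$ exists.
   Context: Local rings are Noetherian. $\mathbb{N}$ denotes the nonnegative integers. A graded family of ideals $\{I_i\}$ in a ring $R$ is a family of ideals indexed by $\mathbb{N}$ such that $I_0=R$ and $I_iI_j\subset I_{i+j}$ for all $i,j$. If $R$ is local and $I_i$ is $m_R$-primary for all $i>0$, then $\{I_i\}$ is called a graded family of $m_R$-primary ideals. $\ell_R(N)$ denotes the length of an $R$-module $N$. *)

(* Defs.v *)
From HB Require Import structures.
From mathcomp Require Import all_boot all_order all_algebra.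
From mathcomp Require Import ring_quotient generic_quotient.
From mathcomp Require Import all_classical all_reals all_analysis.

Set Implicit Arguments.
Unset Strict Implicit.
Unset Printing Implicit Defensive.

Import Order.TTheory GRing.Theory Num.Theory.
Import numFieldNormedType.Exports.

Local Open Scope classical_set_scope.
Local Open Scope ring_scope.
Local Open Scope quotient_scope.

(* The quotient V / N of a module by a submodule: the underlying Z-module is  *)
(* the library's Quotient.quot; only the scaling is added here.               *)
Section QuotientModule.
Variables (R : nzRingType) (V : lmodType R) (N : submodClosed V).

(* [submodClosed] is defined over semirings and does not inherit from         *)
(* [zmodClosed]; this alias of N carries the latter structure.                *)
Definition submod_pred : {pred V} := N.

Fact submod_pred_zmod : zmod_closed submod_pred.
Proof.
split=> [|u v uN vN]; first exact: (rpred0 N).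
rewrite -scaleN1r; apply: (rpredD (S := N)) => //.
exact: (rpredZ (s := N)).
Qed.

HB.instance Definition _ :=
  GRing.isZmodClosed.Build V submod_pred submod_pred_zmod.

Definition quot_lmod : Type := Quotient.quot submod_pred.

HB.instance Definition _ := GRing.Zmodule.on quot_lmod.
HB.instance Definition _ := Quotient.on quot_lmod.

Definition quot_scale (a : R) (x : quot_lmod) : quot_lmod :=
  \pi_quot_lmod (a *: repr x).

Fact pi_scale (a : R) (v : V) :
  quot_scale a (\pi_quot_lmod v) = \pi_quot_lmod (a *: v).
Proof.
apply/eqP; rewrite -Quotient.idealrBE -scalerBr; apply: (rpredZ (s := N)).
by rewrite -[_ \in _]/(_ \in submod_pred) Quotient.idealrBE reprK.
Qed.

Fact quot_scaleA (a b : R) (x : quot_lmod) :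
  quot_scale a (quot_scale b x) = quot_scale (a * b) x.
Proof. by rewrite [quot_scale b x]/quot_scale pi_scale scalerA. Qed.

Fact quot_scale1 : left_id 1 quot_scale.
Proof. by move=> x; rewrite /quot_scale scale1r; exact: reprK. Qed.

Fact quot_scaleDr : right_distributive quot_scale +%R.
Proof.
move=> a x y; rewrite -[x]reprK -[y]reprK.
have piD : {morph \pi_quot_lmod : u v / u + v} by exact: raddfD.
by rewrite -piD !pi_scale scalerDr piD.
Qed.

Fact quot_scaleDl (x : quot_lmod) :
  {morph quot_scale^~ x : a b / a + b}.
Proof.
have piD : {morph \pi_quot_lmod : u v / u + v} by exact: raddfD.
by move=> a b; rewrite /quot_scale scalerDl piD.
Qed.

HB.instance Definition _ := GRing.Zmodule_isLmodule.Build R quot_lmod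
  quot_scaleA quot_scale1 quot_scaleDr quot_scaleDl.

End QuotientModule.

(* Supremum of the lengths of strictly increasing chains of submodules;       *)
(* it is +oo when V does not have finite length.                              *)
Definition module_length (K : realType) (R : nzRingType) (V : lmodType R) :
    \bar K :=
  ereal_sup [set n%:R%:E | n in
    [set n : nat | exists N : nat -> submodClosed V,
       forall i, (i < n)%N -> [set` N i] `<` [set` N i.+1]]].

(* Ideals of R, possibly improper (unlike the library's [idealr]), are the    *)
(* submodules of the R-module R. In particular, [quot_lmod I] is R / I as an  *)
(* R-module.                                                                  *)
Definition ideal (R : comNzRingType) : Type := submodClosed R^o.

Section Ideals.
Variable R : comNzRingType.
Implicit Types (I J m : submodClosed R^o) (s : seq R) (d : nat).

Definition generated_by I s : Prop :=
  forall x : R, x \in I <->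
    exists a : 'I_(size s) -> R, x = \sum_(k < size s) a k * s`_k.

Definition ideal_mul I J : set R :=
  [set x | exists (n : nat) (a b : 'I_n -> R),
     [/\ forall k, a k \in I, forall k, b k \in J
       & x = \sum_(k < n) a k * b k]].

Definition radical I : set R := [set x | exists n : nat, (x ^+ n : R) \in I].

Definition is_proper I : Prop := (1 : R) \notin I.

Definition maximal_ideal m : Prop :=
  is_proper m /\ forall J, [set` m] `<=` [set` J] -> is_proper J ->
    [set` J] = [set` m].

Definition primary I : Prop :=
  is_proper I /\ forall x y : R, x * y \in I -> x \in I \/ radical I y.

Definition primary_to m I : Prop := primary I /\ radical I = [set` m].

End Ideals.

Definition noetherian (R : comNzRingType) : Prop :=
  forall I : ideal R, exists s : seq R, generated_by I s.

Definition local_ring (R : comNzRingType) (m : ideal R) : Prop :=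
  [/\ noetherian R, maximal_ideal m
    & forall m' : ideal R, maximal_ideal m' -> [set` m'] = [set` m]].

Definition prime_chain (R : comNzRingType) (n : nat) : Prop :=
  exists p : nat -> prime_idealr R,
    forall i, (i < n)%N -> [set` p i] `<` [set` p i.+1].

Definition krull_dim_eq (R : comNzRingType) (d : nat) : Prop :=
  prime_chain R d /\ forall n, prime_chain R n -> (n <= d)%N.

Definition regular_local_ring (R : comNzRingType) (m : ideal R) (d : nat) :
    Prop :=
  [/\ local_ring m, krull_dim_eq R d
    & exists2 s : seq R, size s = d & generated_by m s].

Definition graded_family (R : comNzRingType) (I : nat -> ideal R) : Prop :=
  [set` I 0%N] = setT /\
  forall i j, ideal_mul (I i) (I j) `<=` [set` I (i + j)%N].

Definition graded_family_primary (R : comNzRingType) (m : ideal R)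
    (I : nat -> ideal R) : Prop :=
  graded_family I /\ forall i, (0 < i)%N -> primary_to m (I i).

(* Main.v *)
From HB Require Import structures.
Require Import Defs.
From mathcomp Require Import all_boot all_order all_algebra.
From mathcomp Require Import ring_quotient generic_quotient.
From mathcomp Require Import all_classical all_reals all_analysis.
From mathcomp Require Import ring lra.

Import Order.TTheory GRing.Theory Num.Theory.
Import numFieldNormedType.Exports.

Local Open Scope classical_set_scope.
Local Open Scope ring_scope.

(** Let x_1, ..., x_d generate m.  The idea is to replace each I_n by an ideal
of initial monomials, for which lengths become numbers of lattice points, and
to compare the resulting lattice sets for different n by dilation.

Fix a base B and give the exponent u in N^d the weight sum_i u_i B^i.  Weights
are additive and separate the points of the box [0, B)^d, so on the box they
order the monomials x^u lexicographically.  Let F_k be the ideal generated by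
the monomials of weight at least k, and call u initial for an ideal I when x^u
is in I + F_(w(u) + 1), that is, when x^u is the leading term of an element of
I.  Suppose that I contains every x_i^B.  Then F_k is inside I for k large,
and (I + F_k) / (I + F_(k + 1)) is generated by the single monomial of weight k
in the box (by nothing if there is none) and killed by m.  So it has length 1
or 0, and R / I has length the number of points of the box which are not
initial for I ([length_quot_staircase]).  The field R / m enters through leading
coefficients: those outside m can be made 1.

Initial exponents of I and J add up to an initial exponent of any ideal that
contains I J ([initialM]).  Hence, if u is not initial for I_(q p), then
floor(u / q) is not initial for I_p, as otherwise q floor(u / q), which is at
most u, would be initial for I_p^q.  Thus the length for q p is at most q^d
times the length for p.  For N = q p + r one first translates by an element
x_0^(c r) of I_r, at the price of a slab of O(p N^(d - 1)) points
([card_staircase_subdivision]).  So a_N / N^d <= a_p / p^d + O(p / N) for all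
N >= p, which forces a_N / N^d to converge to its infimum
([subdivision_cvg]). *)

(** * Submodules and lengths of quotients *)

Definition is_submodule (R : nzRingType) (V : lmodType R) (P : set V) : Prop :=
  P 0 /\ forall a x y, P x -> P y -> P (a *: x + y).

Lemma submodule_pred {R : nzRingType} {V : lmodType R} (P : set V) :
  is_submodule R V P -> exists N : submodClosed V, [set` N] = P.
Proof.
move=> [P0 PD]; pose p : {pred V} := fun x => `[< P x >].
have pcl : submod_closed p.
  split=> [|a x y]; rewrite !unfold_in; first exact/asboolP.
  by move=> /asboolP Px /asboolP Py; apply/asboolP; exact: PD.
pose M := GRing.isSubmodClosed.Build R V p pcl.
pose N : submodClosed V := HB.pack p M.
exists N; apply/seteqP; split=> x /=.
  by rewrite unfold_in => /asboolP.
by move=> Px; rewrite unfold_in; exact/asboolP.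
Qed.

Lemma pred_submodule {R : nzRingType} {V : lmodType R} (N : submodClosed V) :
  is_submodule R V [set` N].
Proof.
split=> [|a x y] /=; first exact: (rpred0 N).
by move=> xN yN; apply: (rpredD (S := N)) => //; exact: (rpredZ (s := N)).
Qed.

Lemma eq_quot_lmod {R : nzRingType} {V : lmodType R} (N : submodClosed V)
    (x y : V) :
  (\pi_(quot_lmod N) x = \pi_(quot_lmod N) y)%qT <-> x - y \in N.
Proof.
rewrite -[_ \in _]/(_ \in submod_pred N) Quotient.idealrBE.
by split=> [->|/eqP].
Qed.

(** The correspondence between submodules of V / N and submodules of V above N;
it allows lengths of quotients to be computed without mentioning quotients. *)
Lemma module_length_quot (K : realType) {R : nzRingType} {V : lmodType R}
    (N : submodClosed V) :
  module_length K (quot_lmod N) = ereal_sup [set n%:R%:E | n in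
    [set n | exists J : nat -> set V,
      [/\ forall i, is_submodule R V (J i), forall i, [set` N] `<=` J i
        & forall i, (i < n)%N -> J i `<` J i.+1]]].
Proof.
have piD : {morph \pi_(quot_lmod N)%qT : u v / u + v} by exact: raddfD.
have pi0 : \pi_(quot_lmod N)%qT 0 = 0 by exact: raddf0.
have piZ a u : \pi_(quot_lmod N)%qT (a *: u) = a *: \pi_(quot_lmod N)%qT u.
  by rewrite -pi_scale.
congr (ereal_sup (_ @` _)); apply/seteqP; split=> n /=.
  move=> [M chainM]; exists (fun i => \pi_(quot_lmod N)%qT @^-1` [set` M i]).
  split.
  - move=> i; have [M0 MD] := pred_submodule (M i).
    split=> [|a u v] /=; first by rewrite pi0.
    by rewrite piD piZ; exact: MD.
  - move=> i u /= uN; suff -> : \pi_(quot_lmod N)%qT u = 0 by exact: rpred0.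
    by rewrite -pi0; apply/eq_quot_lmod; rewrite subr0.
  - move=> i /chainM [sub ne]; split; first by move=> u /=; exact: sub.
    move=> sub'; apply: ne => y /= yM; rewrite -[y]reprK.
    by apply: sub'; rewrite /= reprK.
move=> [J [Jmod NJ chainJ]].
pose P i := \pi_(quot_lmod N)%qT @` J i.
have PJ i u : P i (\pi_(quot_lmod N)%qT u) -> J i u.
  move=> [v Jv /eq_quot_lmod vuN].
  have [_ JD] := Jmod i; rewrite -[u](subKr v) addrC -scaleN1r.
  by apply: JD => //; exact: NJ.
have [M MP] : {M : nat -> submodClosed (quot_lmod N) |
    forall i, [set` M i] = P i}.
  suff Mi i : exists M : submodClosed (quot_lmod N), [set` M] = P i.
    by exists (fun i => projT1 (cid (Mi i))) => i; exact: projT2 (cid (Mi i)).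
  apply: submodule_pred; have [J0 JD] := Jmod i; split.
    by exists 0; rewrite ?pi0.
  move=> a _ _ [u Ju <-] [v Jv <-]; exists (a *: u + v); first exact: JD.
  by rewrite piD piZ.
exists M => i /chainJ [sub ne]; rewrite !MP; split.
  by move=> _ [u Ju <-]; exists u => //; exact: sub.
by move=> sub'; apply: ne => u Ju; apply: PJ; apply: sub'; exists u.
Qed.

Section Ideals.
Context {R : comNzRingType}.
Implicit Types (P Q : set R) (a f g : R).

Definition is_ideal P : Prop :=
  P 0 /\ forall a f g, P f -> P g -> P (a * f + g).

Lemma is_idealM {P} a {f} : is_ideal P -> P f -> P (a * f).
Proof. by move=> [P0 PD] Pf; rewrite -[a * f]addr0; exact: PD. Qed.

Lemma is_idealD {P f g} : is_ideal P -> P f -> P g -> P (f + g).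
Proof. by move=> [_ PD] Pf Pg; rewrite -[f]mul1r; exact: PD. Qed.

Lemma is_idealB {P f g} : is_ideal P -> P f -> P g -> P (f - g).
Proof. by move=> [_ PD] Pf Pg; rewrite addrC -mulN1r; exact: PD. Qed.

Definition ideal_sum P Q : set R := [set f | exists2 g, P g & Q (f - g)].

Lemma ideal_sum_ideal P Q :
  is_ideal P -> is_ideal Q -> is_ideal (ideal_sum P Q).
Proof.
move=> [P0 PD] [Q0 QD]; split=> [|a f g [f' Pf' Qf'] [g' Pg' Qg']].
  by exists 0; rewrite ?subr0.
exists (a * f' + g'); first exact: PD.
by rewrite opprD addrACA -mulrBr; exact: QD.
Qed.

Lemma ideal_suml P Q : is_ideal Q -> P `<=` ideal_sum P Q.
Proof. by move=> [Q0 _] f Pf; exists f; rewrite ?subrr. Qed.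

Lemma ideal_sumr P Q : is_ideal P -> Q `<=` ideal_sum P Q.
Proof. by move=> [P0 _] f Qf; exists 0; rewrite ?subr0. Qed.

Lemma ideal_sumSr P Q Q' : Q `<=` Q' -> ideal_sum P Q `<=` ideal_sum P Q'.
Proof. by move=> QQ' f [g Pg Qg]; exists g => //; exact: QQ'. Qed.

Lemma ideal_sumSl P P' Q : P `<=` P' -> ideal_sum P Q `<=` ideal_sum P' Q.
Proof. by move=> PP' f [g Pg Qg]; exists g => //; exact: PP'. Qed.

End Ideals.

(** * Monomials ordered by weight *)

Section Weights.
Context {d : nat} (B : nat).
Implicit Types u v : 'I_d -> nat.

Definition weight u : nat := (\sum_(i < d) u i * B ^ i)%N.

Lemma weightD u v : weight (fun i => u i + v i)%N = (weight u + weight v)%N.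
Proof.
by rewrite /weight -big_split /=; apply: eq_bigr => i _; rewrite mulnDl.
Qed.

End Weights.

Lemma weight_lt {d B} (u : 'I_d -> nat) :
  (forall i, u i < B)%N -> (weight B u < B ^ d)%N.
Proof.
elim: d u => [|d IHd] u ltuB; first by rewrite /weight big_ord0.
rewrite /weight big_ord_recr /= expnS.
have := IHd (fun i => u (widen_ord (leqnSn d) i)) (fun i => ltuB _).
rewrite /weight /=; set s := (\sum_(i < d) _)%N => lts.
apply: (@leq_trans ((u ord_max).+1 * B ^ d)).
  by rewrite mulSn ltn_add2r.
by rewrite leq_mul2r ltuB orbT.
Qed.

(** Uniqueness of base B digits: division by B^d reads off the last one. *)
Lemma weight_inj {d B} (u v : 'I_d -> nat) : (forall i, u i < B)%N ->
  (forall i, v i < B)%N -> weight B u = weight B v -> u =1 v.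
Proof.
elim: d u v => [|d IHd] u v ltuB ltvB; first by move=> _ [].
have Bd_gt0 : (0 < B ^ d)%N by rewrite expn_gt0 (leq_ltn_trans _ (ltuB ord0)).
have := IHd (fun i => u (widen_ord (leqnSn d) i))
  (fun i => v (widen_ord (leqnSn d) i)) (fun i => ltuB _) (fun i => ltvB _).
have := weight_lt (fun i => u (widen_ord (leqnSn d) i)) (fun i => ltuB _).
have := weight_lt (fun i => v (widen_ord (leqnSn d) i)) (fun i => ltvB _).
rewrite /weight !big_ord_recr /=.
set s := (\sum_(i < d) u _ * _)%N; set t := (\sum_(i < d) v _ * _)%N.
move=> ltt lts IH eq_st.
have eq_max : u ord_max = v ord_max.
  have := congr1 (fun n => n %/ B ^ d)%N eq_st.
  by rewrite !(addnC _ (_ * _)%N) !divnMDl // !divn_small // !addn0.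
have {}IH := IH _; move: eq_st; rewrite eq_max => /addIn/IH eq_uv i.
case: (unliftP ord_max i) => [j|] -> //.
have -> : lift ord_max j = widen_ord (leqnSn d) j.
  by apply: val_inj; exact: lift_max.
exact: eq_uv.
Qed.

Section Monomials.
Context {R : comNzRingType} {d : nat} (x : 'I_d -> R).
Implicit Types u v : 'I_d -> nat.

Definition monomial u : R := \prod_(i < d) x i ^+ u i.

Lemma monomialD u v :
  monomial (fun i => u i + v i)%N = monomial u * monomial v.
Proof. by rewrite -big_split /=; apply: eq_bigr => i _; rewrite exprD. Qed.

Lemma monomial_single i n :
  monomial (fun j => if j == i then n else 0)%N = x i ^+ n.
Proof.
rewrite /monomial (bigD1 i) //= eqxx big1 ?mulr1 // => j /negbTE ->.
by rewrite expr0.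
Qed.

Lemma monomial_in_ideal (P : set R) i n u : is_ideal P ->
  P (x i ^+ n) -> (n <= u i)%N -> P (monomial u).
Proof.
move=> Pid Px nu; rewrite /monomial (bigD1 i) //= -(subnK nu) exprD mulrC mulrA.
exact: is_idealM.
Qed.

Variable B : nat.

(** The ideal generated by the monomials of weight at least k, as an
intersection: to show that it is contained in P one checks the generators. *)
Definition weight_ideal k : set R :=
  [set f | forall P, is_ideal P ->
     (forall u, (k <= weight B u)%N -> P (monomial u)) -> P f].

Lemma weight_ideal_ideal k : is_ideal (weight_ideal k).
Proof.
split=> [P [P0 _] _ //|a f g Ff Fg P Pid Pmon].
by have [_ PD] := Pid; apply: PD; [exact: Ff|exact: Fg].
Qed.

Lemma monomial_weight_ideal k u :
  (k <= weight B u)%N -> weight_ideal k (monomial u).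
Proof. by move=> ku P _; apply. Qed.

Lemma weight_idealS k l : (k <= l)%N -> weight_ideal l `<=` weight_ideal k.
Proof.
move=> kl f Ff P Pid Pmon; apply: Ff => // u lu.
by apply: Pmon; exact: leq_trans lu.
Qed.

Lemma weight_ideal0 f : weight_ideal 0 f.
Proof.
move=> P Pid Pmon; rewrite -[f]mulr1; apply: is_idealM => //.
suff <- : monomial (fun=> 0%N) = 1 by exact: Pmon.
by rewrite /monomial big1.
Qed.

(** Bilinearity reduces this to monomials, whose weights add up. *)
Lemma weight_idealM k l f g :
  weight_ideal k f -> weight_ideal l g -> weight_ideal (k + l) (f * g).
Proof.
have [_ FD] := weight_ideal_ideal (k + l).
have [F0 _] := weight_ideal_ideal (k + l).
move=> Ff Fg; apply: (Ff (fun f => weight_ideal (k + l) (f * g))).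
  by split=> [|a h h']; rewrite ?mul0r // mulrDl -mulrA; exact: FD.
move=> u ku; apply: (Fg (fun g => weight_ideal (k + l) (monomial u * g))).
  by split=> [|a h h']; rewrite ?mulr0 // mulrDr mulrCA; exact: FD.
move=> v lv; rewrite -monomialD; apply: monomial_weight_ideal.
by rewrite weightD leq_add.
Qed.

(** Every variable has positive weight, so m raises the filtration. *)
Lemma mul_var_weight_ideal i u : (0 < B)%N ->
  weight_ideal (weight B u).+1 (x i * monomial u).
Proof.
move=> B_gt0; rewrite -(expr1 (x i)) -monomial_single -monomialD.
apply: monomial_weight_ideal; rewrite weightD -add1n leq_add2r.
by rewrite /weight (bigD1 i) //= eqxx mul1n ltn_addr // expn_gt0 B_gt0.
Qed.

(** x^u is the leading term (the term of least weight) of an element of I, with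
coefficient 1; this also holds when x^u itself lies deeper in the filtration. *)
Definition initial (I : set R) u : Prop :=
  ideal_sum I (weight_ideal (weight B u).+1) (monomial u).

Lemma initialS (I J : set R) u : I `<=` J -> initial I u -> initial J u.
Proof. by move=> IJ; exact: ideal_sumSl. Qed.

(** The leading term of a product is the product of the leading terms. *)
Lemma initialM (I J L : set R) u v :
  (forall f g, I f -> J g -> L (f * g)) ->
  initial I u -> initial J v -> initial L (fun i => u i + v i)%N.
Proof.
move=> IJL [f If Ff] [g Jg Fg]; exists (f * g); first exact: IJL.
rewrite monomialD weightD.
set p := monomial u in Ff *; set q := monomial v in Fg *.
have -> : p * q - f * g = p * (q - g) + (p - f) * g by ring.
apply: (is_idealD (weight_ideal_ideal _)).
  by rewrite -addnS; apply: weight_idealM => //; exact: monomial_weight_ideal.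
rewrite -addSn; apply: weight_idealM => //; rewrite -(subKr q g).
apply: (is_idealB (weight_ideal_ideal _)).
  exact: monomial_weight_ideal.
exact: weight_idealS (leqnSn _) _ Fg.
Qed.

Lemma initial_monomial (I : set R) u : I (monomial u) -> initial I u.
Proof. by apply: ideal_suml; exact: weight_ideal_ideal. Qed.

(** Multiply by the missing monomial, viewed as an element of the unit ideal. *)
Lemma initial_le (I : set R) u v : is_ideal I ->
  (forall i, u i <= v i)%N -> initial I u -> initial I v.
Proof.
move=> Iid uv Iu.
have -> : v = (fun i => u i + (v i - u i))%N.
  by apply/funext => i; rewrite subnKC.
apply: (initialM I setT) => //; last exact: initial_monomial.
by move=> f g If _; rewrite mulrC; exact: is_idealM.
Qed.

End Monomials.

(** * Length as a number of lattice points *)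

Definition exponent {d B} (u : {ffun 'I_d -> 'I_B}) : 'I_d -> nat :=
  fun i => u i.

Lemma exponent_lt {d B} (u : {ffun 'I_d -> 'I_B}) i : (exponent u i < B)%N.
Proof. exact: ltn_ord. Qed.

Lemma exponent_surj {d B} (v : 'I_d -> nat) : (forall i, v i < B)%N ->
  exists u : {ffun 'I_d -> 'I_B}, exponent u = v.
Proof.
move=> ltvB; exists [ffun i => Ordinal (ltvB i)].
by apply/funext => i; rewrite /exponent ffunE.
Qed.

Lemma weight_exponent_inj {d B} :
  injective (fun u : {ffun 'I_d -> 'I_B} => weight B (exponent u)).
Proof.
move=> u v eq_w; apply/ffunP => i; apply: val_inj.
exact: (weight_inj _ _ (exponent_lt u) (exponent_lt v) eq_w).
Qed.

(** The lattice points under the staircase of leading terms of I. *)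
Definition staircase {R : comNzRingType} {d} (x : 'I_d -> R) B (I : set R) :
    {set {ffun 'I_d -> 'I_B}} :=
  [set u | ~~ `[< initial x B I (exponent u) >]]%SET.

Section Length.
Context {R : comNzRingType} {d : nat} (x : 'I_d -> R) (B : nat).
Implicit Types I J : set R.

Definition in_span (a : R) : Prop :=
  exists c : 'I_d -> R, a = \sum_(i < d) c i * x i.

Hypothesis residue_field : forall a, in_span a \/ exists b, in_span (1 - a * b).
Hypothesis B_gt0 : (0 < B)%N.

Lemma in_stairP I u :
  reflect (~ initial x B I (exponent u)) (u \in staircase x B I).
Proof.
by rewrite inE; apply: (iffP idP) => [/asboolPn|?]; last exact/asboolPn.
Qed.

Lemma span_mul_weight_ideal a u : in_span a ->
  weight_ideal x B (weight B u).+1 (a * monomial x u).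
Proof.
move=> [c ->]; have Fid := weight_ideal_ideal x B (weight B u).+1.
rewrite mulr_suml; elim/big_ind: _ => [|f g Ff Fg|i _]; first by case: Fid.
  exact: is_idealD Fid Ff Fg.
by rewrite -mulrA; apply: (is_idealM _ Fid); exact: mul_var_weight_ideal.
Qed.

Definition contains_powers I := forall i, I (x i ^+ B).

Lemma monomial_box I u : is_ideal I -> contains_powers I ->
  I (monomial x u) \/ exists v : {ffun 'I_d -> 'I_B}, exponent v = u.
Proof.
move=> Iid Ipow.
case: (pselect (forall i, u i < B)%N) => [/exponent_surj|/existsNP[i]].
  by right.
by move=> /negP; rewrite -leqNgt; left; apply: monomial_in_ideal (Ipow i) _.
Qed.

Lemma weight_ideal_top I : is_ideal I -> contains_powers I ->
  weight_ideal x B (B ^ d) `<=` I.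
Proof.
move=> Iid Ipow f; apply=> // u.
case: (monomial_box I u Iid Ipow) => // -[v <-].
by rewrite leqNgt weight_lt // => i; exact: exponent_lt.
Qed.

(** F_k / F_(k + 1) is generated modulo I by at most one monomial: monomials
outside the box are in I, and weights separate the points of the box. *)
Lemma weight_ideal_step I k f : is_ideal I -> contains_powers I ->
  weight_ideal x B k f ->
  let G := ideal_sum I (weight_ideal x B k.+1) in
  G f \/ exists (u : {ffun 'I_d -> 'I_B}) a,
    weight B (exponent u) = k /\ G (f - a * monomial x (exponent u)).
Proof.
move=> Iid Ipow Ff G.
have Fid := weight_ideal_ideal x B k.+1.
have Gid : is_ideal G by exact: ideal_sum_ideal.
have [G0 GD] := Gid.
have Gmon v : (k <= weight B v)%N -> G (monomial x v) \/
    exists u : {ffun 'I_d -> 'I_B}, exponent u = v /\ weight B v = k.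
  rewrite leq_eqVlt => /orP[/eqP kv|kv]; last first.
    by left; apply: ideal_sumr => //; exact: monomial_weight_ideal.
  have [Iv|[u uv]] := monomial_box I v Iid Ipow.
    by left; exact: ideal_suml.
  by right; exists u.
have [[u uk]|noU] := pselect (exists u : {ffun 'I_d -> 'I_B},
    weight B (exponent u) = k); last first.
  left; apply: (Ff G) => // v /Gmon[//|[u [uv vk]]].
  by case: noU; exists u; rewrite uv.
right; exists u; suff [a Ga] : exists a, G (f - a * monomial x (exponent u)).
  by exists a.
apply: (Ff (fun f => exists a, G (f - a * monomial x (exponent u)))).
  split=> [|a g h [b Gb] [c Gc]]; first by exists 0; rewrite mul0r subr0.
  exists (a * b + c); set p := monomial _ _ in Gb Gc *.
  have -> : a * g + h - (a * b + c) * p = a * (g - b * p) + (h - c * p) by ring.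
  exact: GD.
move=> v /Gmon[Gv|[v' [<- v'k]]]; first by exists 0; rewrite mul0r subr0.
exists 1; rewrite mul1r; suff -> : v' = u by rewrite subrr.
by apply: weight_exponent_inj; rewrite v'k uk.
Qed.

(** Division of f in J by I: the leading term of f is cancelled by an element
of I, since its exponent is initial for J and hence for I, and the process
stops because F_(B^d) is contained in I. *)
Lemma staircase_inj I J : is_ideal I -> is_ideal J -> contains_powers I ->
  I `<=` J -> staircase x B I = staircase x B J -> J `<=` I.
Proof.
move=> Iid Jid Ipow IJ stIJ.
have initJI (u : {ffun 'I_d -> 'I_B}) :
    initial x B J (exponent u) -> initial x B I (exponent u).
  by move=> Ju; apply: contrapT => /in_stairP; rewrite stIJ => /in_stairP.
suff JIF k : J `<=` ideal_sum I (weight_ideal x B k).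
  move=> f /(JIF (B ^ d)%N)[g Ig /(weight_ideal_top I Iid Ipow) Ifg].
  by rewrite -(subrK g f); exact: is_idealD Iid Ifg Ig.
elim: k => [|k IHk] f Jf.
  by exists 0; [case: Iid|exact: weight_ideal0].
have [g Ig Ffg] := IHk f Jf.
have Fid := weight_ideal_ideal x B k.+1.
have GIid := ideal_sum_ideal _ _ Iid Fid.
have GJid := ideal_sum_ideal _ _ Jid Fid.
suff GI : ideal_sum I (weight_ideal x B k.+1) (f - g).
  by rewrite -(subrK g f); apply: (is_idealD GIid GI); exact: ideal_suml.
have [//|[u [a [uk Gfgu]]]] := weight_ideal_step I k _ Iid Ipow Ffg.
rewrite -(subrK (a * monomial x (exponent u)) (f - g)).
apply: (is_idealD GIid) => //.
(* A coefficient in m only contributes higher weight; any other coefficient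
   has an inverse b modulo m, which makes the leading coefficient 1. *)
have [a_m|[b ab_m]] := residue_field a.
  by apply: ideal_sumr => //; rewrite -uk; exact: span_mul_weight_ideal.
suff : initial x B I (exponent u) by rewrite /initial uk; exact: is_idealM GIid.
apply: initJI; rewrite /initial uk; move: Gfgu; set p := monomial _ _ => Gfgu.
have -> : p = b * ((f - g) - (f - g - a * p)) + (1 - a * b) * p by ring.
apply: (is_idealD GJid); last first.
  by apply: ideal_sumr => //; rewrite -uk; exact: span_mul_weight_ideal.
apply/(is_idealM _ GJid)/(is_idealB GJid).
  by apply: ideal_suml => //; apply: (is_idealB Jid) => //; exact: IJ.
exact: ideal_sumSl IJ _ Gfgu.
Qed.

Lemma staircaseS I J : I `<=` J -> staircase x B J \subset staircase x B I.
Proof.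
move=> IJ; apply/fintype.subsetP => u /in_stairP nJu; apply/in_stairP => Iu.
by apply: nJu; exact: initialS Iu.
Qed.

(** Each strict inclusion of ideals removes at least one point from the
staircase. *)
Lemma ideal_chain_le I (J : nat -> set R) n : contains_powers I ->
  (forall i, is_ideal (J i)) -> (forall i, I `<=` J i) ->
  (forall i, (i < n)%N -> J i `<` J i.+1) ->
  (n <= #|staircase x B I|)%N.
Proof.
move=> Ipow Jid IJ chainJ.
suff len i : (i <= n)%N -> (i + #|staircase x B (J i)| <= #|staircase x B I|)%N.
  exact: leq_trans (leq_addr _ _) (len n (leqnn n)).
elim: i => [_|i IHi lt_in].
  by rewrite add0n subset_leq_card // staircaseS.
apply: leq_trans (IHi (ltnW lt_in)); rewrite addSnnS leq_add2l.
have [sub nsub] := chainJ i lt_in.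
apply: proper_card; rewrite finset.properEneq staircaseS // andbT.
apply: contra_notN nsub => /eqP eq_st.
by apply: staircase_inj (esym eq_st) => // j; apply: IJ.
Qed.

(** The ideals I + F_k form a chain, which jumps at the weights of the points of
the staircase. *)
Lemma ideal_chain_exists I : is_ideal I -> contains_powers I ->
  exists J : nat -> set R, [/\ forall i, is_ideal (J i), forall i, I `<=` J i
    & forall i, (i < #|staircase x B I|)%N -> J i `<` J i.+1].
Proof.
move=> Iid Ipow.
pose G k := ideal_sum I (weight_ideal x B k).
pose above k := [set u in staircase x B I | (k <= weight B (exponent u))%N]%SET.
have Gid k : is_ideal (G k).
  by apply: ideal_sum_ideal => //; exact: weight_ideal_ideal.
have GS k : G k.+1 `<=` G k.
  by apply: ideal_sumSr; exact: (weight_idealS x B _ _ (leqnSn k)).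
(* Descending induction on k; above k counts the jumps from I up to G k. *)
suff chain j k : (k + j = B ^ d)%N -> exists J : nat -> set R,
    [/\ forall i, is_ideal (J i), forall i, I `<=` J i, forall i, J i `<=` G k
      & forall i, (i < #|above k|)%N -> J i `<` J i.+1].
  have [J [Jid IJ _ chainJ]] := chain (B ^ d)%N 0%N erefl.
  exists J; split=> // i ltin; apply: chainJ; apply: leq_trans ltin _.
  by apply: subset_leq_card; apply/fintype.subsetP => u u_st; rewrite inE u_st.
elim: j k => [|j IHj] k.
  rewrite addn0 => ->; exists (fun=> I); split=> [//|_|_|i].
    exact: subset_refl.
    exact: (ideal_suml I _ (weight_ideal_ideal x B _)).
  suff -> : above (B ^ d)%N = finset.set0 by rewrite cards0.
  apply/finset.setP => u; rewrite !inE leqNgt weight_lt ?andbF //.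
  exact: exponent_lt.
rewrite addnS -addSn => /IHj[J [Jid IJ JG chainJ]].
have [[u [u_st uk]]|noU] := pselect (exists u,
    u \in staircase x B I /\ weight B (exponent u) = k); last first.
  exists J; split=> // [i|i ltin]; first exact: subset_trans (JG i) (GS k).
  apply: chainJ; apply: leq_trans ltin _; apply: subset_leq_card.
  apply/fintype.subsetP => u; rewrite !inE => /andP[u_st ku]; rewrite u_st.
  rewrite ltn_neqAle ku andbT; apply: contra_notN noU => /eqP ku'.
  by exists u; rewrite inE.
pose n := #|above k.+1|.
have card_above : (#|above k| <= n.+1)%N.
  rewrite -add1n -(cards1 u); apply: leq_trans (leq_card_setU _ _).
  apply: subset_leq_card; apply/fintype.subsetP => v.
  rewrite !inE => /andP[v_st]; rewrite leq_eqVlt v_st /= => /orP[/eqP kv|->].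
    by rewrite (weight_exponent_inj v u) ?eqxx //= uk.
  by rewrite orbT.
exists (fun i => if (i <= n)%N then J i else G k); split=> [i|i|i|i ltin].
- by case: ifP.
- by case: ifP => // _; exact: (ideal_suml I _ (weight_ideal_ideal x B _)).
- by case: ifP => _; [exact: subset_trans (JG i) (GS k)|exact: subset_refl].
have /= : (i <= n)%N by rewrite -ltnS; exact: leq_trans ltin card_above.
case: ltngtP => //= [lt_in _|-> _]; first exact: chainJ.
split; first exact: subset_trans (JG n) (GS k).
move=> GkJ; move/in_stairP: u_st; apply.
rewrite /initial uk; apply: (JG n); apply: GkJ; apply: ideal_sumr => //.
by apply: monomial_weight_ideal; rewrite uk.
Qed.

End Length.

Theorem length_quot_staircase (K : realType) {R : comNzRingType} {d : nat}
    (x : 'I_d -> R) (B : nat) (I : ideal R) :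
  (forall a, in_span x a \/ exists b, in_span x (1 - a * b)) -> (0 < B)%N ->
  (forall i, x i ^+ B \in I) ->
  module_length K (quot_lmod I) = #|staircase x B [set` I]|%:R%:E.
Proof.
move=> resf B_gt0 Ipow.
have Iid : is_ideal [set` I] by exact: (pred_submodule I).
rewrite module_length_quot; apply/eqP; rewrite eq_le; apply/andP; split.
  apply: ge_ereal_sup => _ [n [J [Jmod IJ chainJ]] <-].
  rewrite lee_fin ler_nat.
  exact: (ideal_chain_le x B resf B_gt0 [set` I] J).
apply: ereal_sup_ubound; exists #|staircase x B [set` I]| => //=.
have [J [Jid IJ chainJ]] := ideal_chain_exists x B [set` I] Iid Ipow.
by exists J.
Qed.

(** * Comparing the staircases of a graded family *)

Lemma card_ord_lt n k : (#|[pred j : 'I_n | j < k]%N| <= k)%N.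
Proof.
rewrite cardE -(size_map val) -[leqRHS](size_iota 0).
apply: uniq_leq_size.
  by rewrite map_inj_uniq ?enum_uniq //; exact: val_inj.
by move=> _ /mapP[j jk ->]; rewrite mem_iota; rewrite mem_enum in jk.
Qed.

Lemma card_slab d B k :
  (#|[set u : {ffun 'I_d.+1 -> 'I_B} | u ord0 < k]%SET| <= k * B ^ d)%N.
Proof.
pose F (i : 'I_d.+1) := [pred j : 'I_B | (i == ord0) ==> (j < k)%N].
apply: (@leq_trans #|family F|).
  apply: subset_leq_card; apply/fintype.subsetP => u; rewrite inE => uk.
  by apply/familyP => i; rewrite inE; apply/implyP => /eqP ->.
rewrite card_family foldrE big_map big_enum /= big_ord_recl leq_mul //.
  by rewrite (eq_card (B := [pred j : 'I_B | j < k]%N)) ?card_ord_lt.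
rewrite -[d in (_ ^ d)%N]card_ord -prod_nat_const leq_prod // => i _.
by rewrite -[leqRHS]card_ord max_card.
Qed.

Section Subdivision.
Context {R : comNzRingType} {d : nat} (x : 'I_d.+1 -> R) (B c : nat)
  (I : nat -> set R).
Hypothesis Iid : forall n, is_ideal (I n).
Hypothesis I0 : I 0%N = setT.
Hypothesis IM : forall i j f g, I i f -> I j g -> I (i + j)%N (f * g).
Hypothesis Ipow : forall i, I 1%N (x i ^+ c).

Lemma graded_pow i n : I n (x i ^+ (c * n)).
Proof.
elim: n => [|n IHn]; first by rewrite I0.
by rewrite -add1n mulnDr muln1 exprD; exact: IM.
Qed.

Lemma initial_scale p q u :
  initial x B (I p) u -> initial x B (I (q * p)%N) (fun i => q * u i)%N.
Proof.
move=> Iu; elim: q => [|q IHq]; first by apply: initial_monomial; rewrite I0.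
by rewrite mulSn; apply: initialM Iu IHq => f g; exact: IM.
Qed.

(** Here u is at least q floor((u - shift) / q) + shift, where the first term is
initial for I_(q p) and the second for I_r. *)
Lemma initial_subdivision p q r u : (0 < q)%N ->
  let shift i := if i == ord0 then (c * r)%N else 0%N in
  (c * r <= u ord0)%N ->
  initial x B (I p) (fun i => (u i - shift i) %/ q)%N ->
  initial x B (I (q * p + r)%N) u.
Proof.
move=> q_gt0 shift shift_u /(initial_scale _ q) Iqp.
have Ir : initial x B (I r) shift.
  by apply: initial_monomial; rewrite monomial_single; exact: graded_pow.
apply: initial_le (Iid _) _ (initialM x B _ _ _ _ _ _ Iqp Ir); last first.
  by move=> f g; exact: IM.
move=> i; rewrite /= addnC -leq_subRL; first by rewrite mulnC leq_divM.
by rewrite /shift; case: eqP => // ->.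
Qed.

(** Outside the slab u_0 < c r, where the translation by (c r, 0, ..., 0) cannot
be undone, a point is determined by the quotient and the remainder by q of its
translate: the quotient lies under the staircase of I_p and the remainder in
[0, q)^(d + 1).  The number of variables is d + 1, so that there is a first
one. *)
Lemma card_staircase_subdivision p q r : (0 < q)%N ->
  (#|staircase x B (I (q * p + r)%N)|
     <= q ^ d.+1 * #|staircase x B (I p)| + c * r * B ^ d)%N.
Proof.
move=> q_gt0; pose shift (i : 'I_d.+1) := if i == ord0 then (c * r)%N else 0%N.
pose slab := [set u : {ffun 'I_d.+1 -> 'I_B} | (u ord0 < c * r)%N]%SET.
rewrite -(cardsID slab) addnC leq_add //; last first.
  apply: leq_trans (card_slab _ _ _); apply: subset_leq_card.
  exact: subsetIr.
have lt_quo (u : {ffun 'I_d.+1 -> 'I_B}) i : ((u i - shift i) %/ q < B)%N.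
  exact: leq_ltn_trans (leq_trans (leq_div _ _) (leq_subr _ _)) (ltn_ord (u i)).
have lt_rem (u : {ffun 'I_d.+1 -> 'I_B}) i : ((u i - shift i) %% q < q)%N.
  by rewrite ltn_mod.
pose quo_rem (u : {ffun 'I_d.+1 -> 'I_B}) :=
  ([ffun i => Ordinal (lt_quo u i)], [ffun i => Ordinal (lt_rem u i)]).
have mem_diff u : u \in (staircase x B (I (q * p + r)%N) :\: slab)%SET ->
    u \in staircase x B (I (q * p + r)%N) /\ (c * r <= u ord0)%N.
  by rewrite inE [u \in slab]inE -leqNgt => /andP[].
have shift_le (u : {ffun 'I_d.+1 -> 'I_B}) i :
    (c * r <= u ord0)%N -> (shift i <= u i)%N.
  by rewrite /shift; case: eqP => // ->.
have quo_rem_inj : {in (staircase x B (I (q * p + r)%N) :\: slab)%SET &,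
    injective quo_rem}.
  move=> u v /mem_diff[_ u0] /mem_diff[_ v0] [/ffunP quo_uv /ffunP rem_uv].
  apply/ffunP => i; apply: val_inj.
  move: (quo_uv i) (rem_uv i); rewrite !ffunE => -[quo_i] [rem_i].
  rewrite /= -(subnK (shift_le u i u0)) -(subnK (shift_le v i v0)).
  by rewrite (divn_eq (u i - _) q) quo_i rem_i -divn_eq.
rewrite -(card_in_imset quo_rem_inj) [leqRHS]mulnC.
have -> : (q ^ d.+1 = #|[set: {ffun 'I_d.+1 -> 'I_q}]%SET|)%N.
  by rewrite cardsT card_ffun !card_ord.
rewrite -cardsX; apply: subset_leq_card; apply/fintype.subsetP => w.
move=> /imsetP[u /mem_diff[/in_stairP nIu u0] ->].
rewrite finset.in_setX finset.in_setT andbT.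
apply/in_stairP => Iquo; apply/nIu/(initial_subdivision p q r) => //.
suff <- : exponent (quo_rem u).1 = (fun i => (u i - shift i) %/ q)%N by [].
by apply/funext => i; rewrite /exponent ffunE.
Qed.

End Subdivision.

(** * Convergence *)

(** A Fekete type argument.  Dividing by N^(d + 1) gives
a_N / N^(d + 1) <= a_p / p^(d + 1) + C p / N, because (N / p) p <= N; the limit
is the infimum of the sequence over p > 0. *)
Lemma subdivision_cvg (K : realType) (d C : nat) (a : nat -> nat) :
  (forall p N, (0 < p <= N)%N ->
     (a N <= (N %/ p) ^ d.+1 * a p + C * p * N ^ d)%N) ->
  exists l : K, ((a n)%:R / (n ^ d.+1)%:R : K) @[n --> \oo] --> l.
Proof.
move=> aN; pose u n : K := (a n)%:R / (n ^ d.+1)%:R.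
have uN p N : (0 < p <= N)%N -> u N <= u p + (C * p)%:R / N%:R.
  move=> /andP[p_gt0 pN]; have N_gt0 := leq_trans p_gt0 pN.
  have N0 : N%:R != 0 :> K by rewrite pnatr_eq0 -lt0n.
  rewrite /u ler_pdivrMr ?ltr0n ?expn_gt0 ?N_gt0 // mulrDl.
  have -> : (C * p)%:R / N%:R * (N ^ d.+1)%:R = (C * p * N ^ d)%:R :> K.
    by rewrite expnS !natrM; field.
  have := aN p N; rewrite p_gt0 pN => /(_ isT); rewrite -(ler_nat K) natrD.
  move=> /le_trans; apply; rewrite lerD2r mulrAC.
  rewrite ler_pdivlMr ?ltr0n ?expn_gt0 ?p_gt0 // -!natrM ler_nat.
  by rewrite mulnAC mulnC leq_mul // -expnMn leq_exp2r // leq_divM.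
pose E := [set u p | p in [set p | (0 < p)%N]].
have infE : has_inf E.
  split; first by exists (u 1%N); exists 1%N.
  by exists 0 => _ [p _ <-]; rewrite divr_ge0.
exists (inf E); apply/cvgrPdist_lt => e e_gt0.
have e2_gt0 : 0 < e / 2 by rewrite divr_gt0.
have [_ [p /= p_gt0 <-] up] := inf_adherent e2_gt0 infE.
near=> N.
have pN : (p <= N)%N by near: N; exact: nbhs_infty_ge.
have N_gt0 := leq_trans p_gt0 pN.
have CpN : (C * p)%:R / N%:R < e / 2.
  rewrite ltr_pdivrMr ?ltr0n // mulrC -ltr_pdivrMr //.
  by near: N; exact: nbhs_infty_gtr.
have leN : inf E <= u N by apply: ge_inf; [case: infE|exists N].
have := uN p N; rewrite p_gt0 pN => /(_ isT) uNp.
rewrite ltr_norml -/(u N); apply/andP; split; lra.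
Unshelve. all: by end_near.
Qed.

(** If a is not in m, then m and a generate the unit ideal. *)
Lemma maximal_ideal_inverse {R : comNzRingType} {m : ideal R} (a : R) :
  maximal_ideal m -> a \in m \/ exists b, 1 - a * b \in m.
Proof.
move=> [_ m_max].
have mid : is_ideal [set` m] by exact: (pred_submodule m).
case: (boolP (a \in m)) => [|a_m]; [by left|right].
pose J : set R := [set f | exists b, f - a * b \in m].
have [M MJ] : exists M : ideal R, [set` M] = J.
  apply: submodule_pred; split=> [|c f g [b fb] [b' gb']].
    by exists 0; rewrite mulr0 subr0; exact: mid.1.
  exists (c * b + b').
  have -> : c *: f + g - a * (c * b + b') = c * (f - a * b) + (g - a * b').
    by rewrite -[c *: f]/(c * f); ring.
  exact: mid.2.
apply: contrapT => noinv; move/negP: a_m; apply.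
suff : [set` m] a by [].
rewrite -(m_max M) => [|f|]; rewrite ?MJ.
- by exists 1; rewrite mulr1 subrr; exact: mid.1.
- by move=> fm; exists 0; rewrite mulr0 subr0.
- by apply/negP => M1; apply: noinv; have : [set` M] 1 by []; rewrite MJ.
Qed.

Theorem theorem4p6 (K : realType) (R : comNzRingType) (d : nat) (m : ideal R)
    (hd : (0 < d)%N) (hR : regular_local_ring m d)
    (I : nat -> ideal R) (hI : graded_family_primary m I) :
  exists l : K,
    (module_length K (quot_lmod (I n)) / ((n ^ d)%:R)%:E)%E @[n --> \oo]
      --> l%:E.
Proof.
case: d hd hR => // d _ hR.
have [[_ m_max _] _ [s s_size ms]] := hR.
have [x mx] : exists x : 'I_d.+1 -> R, forall a, a \in m <-> in_span x a.
  by rewrite -s_size; exists (fun i => s`_i) => a; exact: ms.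
have resf a : in_span x a \/ exists b, in_span x (1 - a * b).
  have [/mx|[b /mx]] := maximal_ideal_inverse a m_max; first by left.
  by right; exists b.
have [[I0 IM] Iprim] := hI.
have Iid n : is_ideal [set` I n] by exact: (pred_submodule (I n)).
have {}IM i j f g : f \in I i -> g \in I j -> f * g \in I (i + j)%N.
  move=> If Ig; apply: (IM i j); exists 1%N, (fun=> f), (fun=> g).
  by rewrite big_ord1.
have [c c_gt0 Ipow] : exists2 c, (0 < c)%N & forall i, x i ^+ c \in I 1%N.
  (* A common exponent for all the x_i, which lie in the radical m of I_1. *)
  have xrad i : exists n, x i ^+ n \in I 1%N.
    have [_ rad] := Iprim 1%N isT.
    have : [set` m] (x i).
      apply/mx; exists (fun j => (j == i)%:R).
      rewrite (bigD1 i) //= eqxx mul1r big1 ?addr0 // => j /negbTE ->.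
      by rewrite mul0r.
    by rewrite -rad.
  have [e xe] := choice xrad.
  exists (\max_i e i).+1 => // i.
  have lt_e : (e i <= (\max_i e i).+1)%N by apply/leqW/leq_bigmax.
  rewrite -(subnK lt_e) exprD; exact: (is_idealM _ (Iid 1%N) (xe i)).
pose a n := #|staircase x (c * n) [set` I n]|.
(* The base c N serves at once for all n <= N: x_i^(c n) is in I_n. *)
have length_box n N : (0 < N)%N -> (n <= N)%N ->
    module_length K (quot_lmod (I n)) = #|staircase x (c * N) [set` I n]|%:R%:E.
  move=> N_gt0 nN; apply: length_quot_staircase => // [|i].
    by rewrite muln_gt0 c_gt0.
  rewrite -(subnK nN) mulnDr exprD; apply: (is_idealM _ (Iid n)).
  exact: (graded_pow x c (fun n => [set` I n]) I0 IM Ipow).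
have [l al] : exists l : K, ((a n)%:R / (n ^ d.+1)%:R : K) @[n --> \oo] --> l.
  apply: (subdivision_cvg K d (c ^ d.+1)%N) => p N /andP[p_gt0 pN].
  have N_gt0 := leq_trans p_gt0 pN.
  (* The count for I_p does not depend on the base, being a length. *)
  have -> : a p = #|staircase x (c * N) [set` I p]|.
    apply/eqP; rewrite -(eqr_nat K) -eqe; apply/eqP.
    by rewrite -!length_box.
  have := card_staircase_subdivision x (c * N) c (fun n => [set` I n])
    Iid I0 IM Ipow p (N %/ p) (N %% p).
  rewrite divn_gt0 // pN -divn_eq => /(_ isT) /leq_trans; apply.
  rewrite leq_add2l expnMn mulnACA -expnS -[leqRHS]mulnA leq_mul // leq_mul2r.
  by rewrite (ltnW (ltn_pmod _ _)) ?orbT.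
exists l; apply: cvg_trans (cvg_EFin (f := fun n => _%:E) _ al); last first.
  exact: nearW.
apply: near_eq_cvg; near=> n.
have n_gt0 : (0 < n)%N by near: n; exact: nbhs_infty_gt.
rewrite (length_box n n) // inver pnatr_eq0 expn_eq0.
by rewrite eqn0Ngt n_gt0.
Unshelve. all: by end_near.
Qed.
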